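(* For every integer $k \geq 0$, the neighborhood complex $\mathcal{N}(S_{2,k})$ of the graph $S_{2,k}$ simplicially collapses onto the neighborhood complex $\mathcal{N}(SG_{2,k})$ of the stable Kneser graph $SG_{2,k}$.
   Context: Let $[n]=\{1,\dots,n\}$. The Kneser graph $KG_{2,k}$ has as vertices the 2-element subsets $\{i,j\}$ ($i\neq j$) of $[k+4]$, and two vertices $v_1,v_2$ are adjacent if and only if $v_1\cap v_2=\emptyset$. A vertex $\{i,j\}$ is stable if $j\neq i\pm 1$ modulo $k+4$ (arithmetic on elements of $[k+4]$ is modulo $k+4$, so $k+5$ is identified with $1$ and $0$ with $k+4$); otherwise it is unstable. The stable Kneser graph $SG_{2,k}$ is the induced subgraph of $KG_{2,k}$ on the stable vertices. The graph $S_{2,k}$ is the subgraph of $KG_{2,k}$ with the same vertex set $V(S_{2,k})=V(KG_{2,k})$ and with edge set consisting of those edges $(u,v)$ of $KG_{2,k}$ such that at least one of $u,v$ is stable. The neighborhood complex $\mathcal{N}(G)$ of a graph $G$ is the abstract simplicial complex whose vertices are the non-isolated vertices of $G$ and whose simplices are the subsets of $V(G)$ having a common neighbor in $G$. Let $X$ be a simplicial complex and $\sigma\subsetneq\tau$ simplices of $X$ such that $\tau$ is the only maximal simplex of $X$ containing $\sigma$. A simplicial collapse of $X$ is the simplicial complex obtained from $X$ by removing all simplices $\gamma$ with $\sigma\subseteq\gamma\subseteq\tau$. A complex $X$ simplicially collapses onto $Z$ (written $X\searrow Z$) if there is a finite (possibly empty) sequence of simplicial collapses from $X$ to $Z$.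 *)

(* Defs.v *)
From Stdlib Require Import Relation_Operators.
From HB Require Import structures.
From mathcomp Require Import all_boot all_order all_algebra.

Set Implicit Arguments.
Unset Strict Implicit.
Unset Printing Implicit Defensive.

(* Simple graphs whose vertex set is a subset of a finite ambient type T. All
   graphs and complexes below live on the same ambient type, so that being a
   subgraph, or a subcomplex, is plain inclusion. *)
Record sgraph (T : finType) := SGraph {
  verts : {set T};
  adj : rel T;
  adj_sym : symmetric adj;
  adj_irrefl : irreflexive adj;
  adj_verts : forall u v, adj u v -> (u \in verts) && (v \in verts)
}.

Section Subgraphs.

Variables (T : finType) (G : sgraph T) (W : {set T}).

Definition induced_adj : rel T := [rel u v | [&& u \in W, v \in W & adj G u v]].

Fact induced_adj_sym : symmetric induced_adj.
Proof. by move=> u v; rewrite /induced_adj /= adj_sym andbCA. Qed.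

Fact induced_adj_irrefl : irreflexive induced_adj.
Proof. by move=> u; rewrite /induced_adj /= adj_irrefl !andbF. Qed.

Fact induced_adj_verts u v :
  induced_adj u v -> (u \in verts G :&: W) && (v \in verts G :&: W).
Proof. by case/and3P=> uW vW /adj_verts/andP[uG vG]; rewrite !inE uG uW vG. Qed.

Definition induced_subgraph : sgraph T :=
  SGraph induced_adj_sym induced_adj_irrefl induced_adj_verts.

(* The spanning subgraph formed by the edges with at least one end in W. *)
Definition incident_adj : rel T :=
  [rel u v | adj G u v && ((u \in W) || (v \in W))].

Fact incident_adj_sym : symmetric incident_adj.
Proof. by move=> u v; rewrite /incident_adj /= adj_sym orbC. Qed.

Fact incident_adj_irrefl : irreflexive incident_adj.
Proof. by move=> u; rewrite /incident_adj /= adj_irrefl. Qed.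

Fact incident_adj_verts u v :
  incident_adj u v -> (u \in verts G) && (v \in verts G).
Proof. by case/andP=> /adj_verts. Qed.

Definition incident_subgraph : sgraph T :=
  SGraph incident_adj_sym incident_adj_irrefl incident_adj_verts.

End Subgraphs.

(* The set [k+4] is represented by 'I_k.+4, each element by its residue modulo
   k+4 (so k+4 is represented by 0); the operations of the ring 'I_k.+4 are the
   arithmetic modulo k+4. *)
Section KneserGraphs.

Variable k : nat.

Definition kneser_verts : {set {set 'I_k.+4}} := [set v : {set 'I_k.+4} | #|v| == 2].

Definition kneser_adj : rel {set 'I_k.+4} :=
  [rel u v | [&& u \in kneser_verts, v \in kneser_verts & u :&: v == set0]].

Fact kneser_adj_sym : symmetric kneser_adj.
Proof. by move=> u v; rewrite /kneser_adj /= andbCA setIC. Qed.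

Fact kneser_adj_irrefl : irreflexive kneser_adj.
Proof.
move=> u; rewrite /kneser_adj /= inE setIid.
by have [->|] := eqVneq u set0; rewrite ?cards0 ?andbF.
Qed.

Fact kneser_adj_verts u v :
  kneser_adj u v -> (u \in kneser_verts) && (v \in kneser_verts).
Proof. by case/and3P=> -> ->. Qed.

Definition KG2 : sgraph {set 'I_k.+4} :=
  SGraph kneser_adj_sym kneser_adj_irrefl kneser_adj_verts.

Definition stable_verts : {set {set 'I_k.+4}} :=
  [set v : {set 'I_k.+4} in verts KG2 |
    [forall i in v, forall j in v, (j != i + 1) && (j != i - 1)]%R].

Definition SG2 : sgraph {set 'I_k.+4} := induced_subgraph KG2 stable_verts.

Definition S2 : sgraph {set 'I_k.+4} := incident_subgraph KG2 stable_verts.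

End KneserGraphs.

(* Finite abstract simplicial complexes, given by their nonempty simplices; x
   is a vertex of the complex when [set x] is a simplex. *)
Definition is_complex (T : finType) (F : {set {set T}}) : bool :=
  (set0 \notin F) &&
  [forall A in F, forall B : {set T},
    (B \subset A) && (B != set0) ==> (B \in F)].

Record complex (T : finType) := Complex {
  simplices :> {set {set T}};
  _ : is_complex simplices
}.

HB.instance Definition _ (T : finType) := [isSub for @simplices T].

Section NeighborhoodComplex.

Variables (T : finType) (G : sgraph T).

Definition neighborhood_simplices : {set {set T}} :=
  [set A : {set T} | [&& A != set0, A \subset verts G &
     [exists w in verts G, forall u in A, adj G w u]]].

Fact neighborhood_is_complex : is_complex neighborhood_simplices.
Proof.
apply/andP; split; first by rewrite inE eqxx.
apply/forall_inP=> A; rewrite inE => /and3P[_ AG /exists_inP[w wG /forall_inP wA]].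
apply/forallP=> B; apply/implyP=> /andP[BA B0]; rewrite inE B0 (subset_trans BA AG).
apply/exists_inP; exists w => //; apply/forall_inP=> u uB.
exact: wA (subsetP BA u uB).
Qed.

Definition neighborhood_complex : complex T := Complex neighborhood_is_complex.

Fact neighborhood_complex_vertex v :
  ([set v] \in simplices neighborhood_complex) = [exists w, adj G v w].
Proof.
rewrite inE; apply/and3P/existsP => [[_ _ /exists_inP[w _ /forall_inP wv]]|[w vw]].
  by exists w; rewrite adj_sym wv ?set11.
have /andP[vG wG] := adj_verts vw; split; last 1 first.
- apply/exists_inP; exists w => //; apply/forall_inP=> u /set1P->.
  by rewrite adj_sym.
- by apply/set0Pn; exists v; rewrite set11.
- by rewrite sub1set.
Qed.

End NeighborhoodComplex.

Section Collapses.

Variable T : finType.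

Definition maximal_simplex (X : complex T) (A : {set T}) : bool :=
  maxset [in simplices X] A.

Definition collapse_pair (X : complex T) (s t : {set T}) : Prop :=
  [/\ s \in simplices X, t \in simplices X, s \proper t &
      forall A, maximal_simplex X A && (s \subset A) <-> A = t].

Definition elementary_collapse (X Y : complex T) : Prop :=
  exists s t, collapse_pair X s t /\
    simplices Y =
      simplices X :\: [set g : {set T} | (s \subset g) && (g \subset t)].

Definition collapses : complex T -> complex T -> Prop :=
  clos_refl_trans_1n (complex T) elementary_collapse.

End Collapses.

(* Main.v *)
(* A collapse from X onto Z amounts to emptying the family X \ Z by successively removing intervals
   [s, t] whose bottom s has no other supersets in what is left of the family. A family closed under
   adding and under removing a fixed element p can be emptied in this way, and families can be
   emptied fibre by fibre along a monotone map. A simplex A of N(S_{2,k}) outside N(SG_{2,k}) is of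
   one of two kinds.

   - A consists of stable pairs and its only common neighbour is an unstable pair {i, i+1}: then A is
     an edge cover, without isolated points, of the complement of the path formed by the k+2 points
     other than i, i+1. The first point v and the second point w of a path are non-adjacent in its
     complement, where every neighbour of w is a neighbour of v; this lets v be deleted, and
     repeating it ends with a single point, which has no edge cover.

   - A contains an unstable pair, and some stable pair is disjoint from all its members. Take the
     last i with {i, i+1} in A. For each other point x let e_x be a stable pair {i, x} or {i+1, x}.
     If some point x lies in a member of A other than e_x, then e_x can be toggled. Otherwise A
     consists of {i, i+1} and of the e_x with x in a set S; if t is the first point not in S, toggle
     e_(t+1): the complement of S has a point non-adjacent to t, so it contains a stable pair even
     without t+1. *)
Require Import Defs.
From mathcomp Require Import all_boot all_order all_algebra.
From mathcomp Require Import zify.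

Set Implicit Arguments.
Unset Strict Implicit.
Unset Printing Implicit Defensive.

(** * Families of sets emptied by removing intervals *)

Section Reducible.

Variable T : finType.
Implicit Types (F : {set {set T}}) (A B s t : {set T}) (p : T).

(** Stated for arbitrary families, so that it applies to a difference of two complexes and to pieces
    of it; supersets of [s] are looked for in the family alone. *)
Inductive reducible : {set {set T}} -> Prop :=
| reducible0 : reducible set0
| reducibleS F s t :
    s \in F -> t \in F -> s \proper t ->
    (forall A, A \in F -> s \subset A -> A \subset t) ->
    reducible (F :\: [set g : {set T} | (s \subset g) && (g \subset t)]) ->
    reducible F.

(** As [Y] is closed under nonempty subsets, all simplices of [X] above a face [s] outside [Y] are
    outside [Y] too. So the interval removed is the whole star of [s] in [X], and [t] is the only
    maximal simplex above [s]. *)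
Lemma reducible_collapses (X Y : complex T) :
  simplices Y \subset simplices X -> reducible (simplices X :\: simplices Y) ->
  collapses X Y.
Proof.
move=> YX; move DF: (simplices X :\: simplices Y) => F redF.
elim: redF X DF YX => {F} [|F s t sF tF st maxt _ IH] X DF YX.
  suff ->: X = Y by apply: Relation_Operators.rt1n_refl.
  by apply/val_inj/eqP; rewrite eqEsubset YX /= andbT -setD_eq0 DF.
have /andP[X0 /forall_inP Xdown] : is_complex (simplices X) by case: (X).
have /andP[Y0 /forall_inP Ydown] : is_complex (simplices Y) by case: (Y).
set I := [set g : {set T} | _] in IH.
have [/setDP[sX sY] /setDP[tX tY]] : s \in simplices X :\: simplices Y /\
  t \in simplices X :\: simplices Y by rewrite DF.
have s0 : s != set0 by apply: contraNneq X0 => <-.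
have upF A : A \in simplices X -> s \subset A -> A \in F.
  move=> AX sA; rewrite -DF inE AX andbT; apply: contra sY => AY.
  by have /forallP/(_ s)/implyP := Ydown A AY; apply; rewrite sA.
have cX' : is_complex (simplices X :\: I).
  rewrite /is_complex !inE (negPf X0) andbF /=.
  apply/forall_inP=> A /setDP[AX AI]; apply/forallP=> B; apply/implyP=> /andP[BA B0].
  have BX : B \in simplices X.
    by have /forallP/(_ B)/implyP := Xdown A AX; apply; rewrite BA.
  rewrite inE BX andbT; apply: contra AI; rewrite !inE => /andP[sB _].
  by rewrite (subset_trans sB BA) maxt ?upF // (subset_trans sB).
apply: (@Relation_Operators.rt1n_trans _ _ _ (Complex cX')).
  exists s, t; split=> //; split=> // A; split=> [/andP[/maxsetP[AX Amax] sA] | ->].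
    by apply/esym/Amax => //; apply: maxt => //; apply: upF.
  rewrite (proper_sub st) andbT; apply/maxsetP; split=> // B BX tB.
  have sB := subset_trans (proper_sub st) tB.
  by apply/eqP; rewrite eqEsubset tB maxt ?upF.
apply: IH => /=; first by rewrite setDDl setUC -setDDl DF.
apply/subsetP=> A AY; rewrite inE (subsetP YX) // andbT.
apply: contra sY; rewrite inE => /andP[sA _].
by have /forallP/(_ s)/implyP := Ydown A AY; apply; rewrite sA.
Qed.

(** [F1] is emptied first: the bottom of each of its intervals has no superset in [F2]. *)
Lemma reducibleU F1 F2 :
  (forall A B, A \in F1 -> B \in F2 -> ~~ (A \subset B)) ->
  reducible F1 -> reducible F2 -> reducible (F1 :|: F2).
Proof.
move=> up red1 red2; elim: red1 up => {F1} [|F s t sF tF st maxt _ IH] up.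
  by rewrite set0U.
apply: (@reducibleS _ s t); rewrite ?inE ?sF ?tF //.
  move=> A /setUP[/maxt|AF2 sA]; first exact.
  by have := up s A sF AF2; rewrite sA.
set I := [set _ | _].
have ->: (F :|: F2) :\: I = (F :\: I) :|: F2.
  rewrite setDUl; congr (_ :|: _); apply/setP=> A; rewrite !inE.
  case AF2: (A \in F2); rewrite ?andbF // andbT.
  by rewrite (negPf (up s A sF AF2)).
by apply: IH => A B /setDP[AF _]; apply: up.
Qed.

Lemma reducible_upset F (U : pred {set T}) :
  (forall A B, A \in F -> B \in F -> A \subset B -> U A -> U B) ->
  reducible [set A in F | U A] -> reducible [set A in F | ~~ U A] ->
  reducible F.
Proof.
move=> up red1 red2.
have ->: F = [set A in F | U A] :|: [set A in F | ~~ U A].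
  by apply/setP=> A; rewrite !inE -andb_orr orbN andbT.
apply: reducibleU => // A B; rewrite !inE => /andP[AF UA] /andP[BF].
by apply: contra => AB; apply: up AB UA.
Qed.

(** An inclusion-maximal [A] contains [p], and every member above [A :\ p] lies in [A]. The interval
    from [A :\ p] to [A] can thus go, and what is left is still closed under toggling [p]. *)
Lemma reducible_toggle F p :
  (forall A, A \in F -> (p |: A \in F) && (A :\ p \in F)) -> reducible F.
Proof.
have [n] := ubnP #|F|; elim: n F => // n IH F; rewrite ltnS => Fn tog.
have [->|[A0 A0F]] := set_0Vmem F; first exact: reducible0.
have [A /maxsetP[AF Amax] _] := @maxset_exists _ [in F] A0 A0F.
have /andP[pAF ApF] := tog A AF.
have pA : p \in A by rewrite -(Amax _ pAF (subsetUr _ _)) setU11.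
have maxA B : B \in F -> A :\ p \subset B -> B \subset A.
  move=> BF AB; have /andP[pBF _] := tog B BF.
  by rewrite -(Amax _ pBF) ?subsetUr // -(setD1K pA) setUS.
apply: (@reducibleS _ (A :\ p) A); rewrite ?properD1 //.
set I := [set _ | _]; apply: IH => [|B].
  apply: leq_trans Fn; rewrite (cardsD1 A F) AF add1n ltnS.
  apply/subset_leq_card/subsetP => B; rewrite !in_setD1 in_setD inE => /andP[BI ->].
  by rewrite andbT; apply: contraNneq BI => ->; rewrite subxx subD1set.
have togI C : ((p |: C \in I) = (C \in I)) * ((C :\ p \in I) = (C \in I)).
  split; rewrite !inE; first by rewrite !subDset setUA setUid subUset sub1set pA.
  by rewrite subsetD1 setD11 andbT (subDset C) (setUidPr _) ?sub1set.
move=> /setDP[BF BI]; have /andP[pBF BpF] := tog B BF.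
by rewrite !in_setD !togI BI pBF BpF.
Qed.

(** Split off the up-set of one property [P i] that occurs, and toggle [p i] there. No toggle
    changes any of the properties, so the remaining members satisfy the same hypotheses. *)
Lemma reducible_toggles (I : finType) F (P : I -> pred {set T}) (p : I -> T) :
  (forall A, A \in F -> exists i, P i A) ->
  (forall i A B, A \in F -> B \in F -> A \subset B -> P i A -> P i B) ->
  (forall i A, A \in F -> P i A -> (p i |: A \in F) && (A :\ p i \in F)) ->
  (forall i j A, A \in F -> P i A ->
     (P j (p i |: A) = P j A) * (P j (A :\ p i) = P j A)) ->
  reducible F.
Proof.
have [n] := ubnP #|F|; elim: n F => // n IH F; rewrite ltnS => Fn exP mono tog inv.
have [->|[A0 A0F]] := set_0Vmem F; first exact: reducible0.
have [i Pi] := exP A0 A0F.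
apply: (@reducible_upset F (P i)) => [A B|/=|/=]; first exact: mono.
  apply: (@reducible_toggle _ (p i)) => A /setIdP[AF PA].
  by have /andP[? ?] := tog i A AF PA; rewrite !inE !inv // PA !andbT; apply/andP.
apply: IH => [|A /setIdP[/exP //]|j A B /setIdP[AF _] /setIdP[BF _]|j A /setIdP[AF nA] PA|j l A /setIdP[AF _]].
- apply: leq_trans Fn; apply: proper_card; apply/properP.
  split; first by apply/subsetP=> A /setIdP[].
  by exists A0; rewrite // inE Pi andbF.
- exact: mono.
- by rewrite !inE !inv // nA !andbT; apply: tog.
- exact: inv.
Qed.

(** The fibres are those of the map sending [A] to the last [i] with [P i A], which is monotone
    because each [P i] is closed upwards; the fibre of the largest index is emptied first. *)
Lemma reducible_last n F (P : nat -> pred {set T}) :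
  (forall A, A \in F -> exists2 i, i < n & P i A) ->
  (forall i A B, A \in F -> B \in F -> A \subset B -> P i A -> P i B) ->
  (forall i, i < n ->
     reducible [set A in F | P i A & [forall j : 'I_n, (i < j) ==> ~~ P j A]]) ->
  reducible F.
Proof.
elim: n F => [|n IH] F exP mono red.
  suff ->: F = set0 by apply: reducible0.
  by apply/setP=> A; rewrite inE; apply/negP=> /exP[].
apply: (@reducible_upset F (P n)) => [A B|/=|/=]; first exact: mono.
  have := red n (leqnn _); congr reducible; apply/setP=> A; rewrite !inE.
  congr (_ && _); rewrite andb_idr // => _; apply/forallP=> j.
  by rewrite ltnNge -ltnS ltn_ord.
apply: IH => [A /setIdP[/exP[i]]|i A B /setIdP[AF _] /setIdP[BF _]|i ltin].
- rewrite ltnS leq_eqVlt => /predU1P[->|ltin PA nA]; last by exists i.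
  by move=> ->.
- exact: mono.
have := red i (ltnW ltin); congr reducible; apply/setP=> A; rewrite !inE -!andbA.
congr (_ && _); rewrite andbCA; congr (_ && _).
apply/forallP/andP=> [nP|[nPn /forallP nP] j].
  split; first by have := nP ord_max; rewrite /= ltin.
  by apply/forallP=> j; have := nP (widen_ord (leqnSn n) j).
apply/implyP=> ltij; have := ltn_ord j; rewrite ltnS leq_eqVlt => /predU1P[->//|ltjn].
by have /implyP := nP (Ordinal ltjn); apply.
Qed.

(** Adding [d] is a bijection from [F] to [F'] that preserves and reflects inclusion, so it carries
    intervals to intervals. *)
Lemma reducible_link d F F' :
  (forall A, (A \in F') = (d \in A) && (A :\ d \in F)) ->
  (forall A, A \in F -> d \notin A) -> reducible F -> reducible F'.
Proof.
move=> F'E dF redF; elim: redF F' F'E dF => {F} [|F s t sF tF st maxt _ IH] F' F'E dF.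
  suff ->: F' = set0 by apply: reducible0.
  by apply/setP=> A; rewrite F'E !inE andbF.
have [ds dt] := (dF s sF, dF t tF).
have ds' A : d \in A -> (d |: s \subset A) = (s \subset A :\ d).
  by move=> dA; rewrite subUset sub1set dA subsetD1 ds andbT.
have dt' A : d \in A -> (A \subset d |: t) = (A :\ d \subset t).
  by move=> dA; rewrite subDset.
apply: (@reducibleS _ (d |: s) (d |: t)).
- by rewrite F'E setU11 setU1K.
- by rewrite F'E setU11 setU1K.
- by rewrite properE ds' ?setU11 // -subDset !setU1K // -properE.
- by move=> A; rewrite F'E => /andP[dA AF]; rewrite ds' // dt' //; apply: maxt.
apply: IH => [A|A /setDP[AF _]]; last exact: dF.
rewrite !in_setD F'E; have [dA|] := boolP (d \in A); last by rewrite andbF.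
by rewrite !inE ds' // dt'.
Qed.

End Reducible.

(** * Edge covers of a graph and deletion of a vertex *)

Section EdgeCovers.

Variables (I : finType) (G : {set {set I}}).
Hypothesis G2 : forall e, e \in G -> #|e| = 2.

(** Asking for equality also confines the edges to [V]: these are the edge covers of the subgraph
    induced on [V]. *)
Definition edge_covers (V : {set I}) : {set {set {set I}}} :=
  [set A : {set {set I}} | (A \subset G) && (cover A == V)].

Lemma edge_other e v : e \in G -> v \in e -> exists2 x, x != v & e = [set v; x].
Proof.
move=> eG ve; have := cardsD1 v e; rewrite ve G2 // => -[/esym/eqP/cards1P[x ex]].
have : x \in e :\ v by rewrite ex set11.
by rewrite !inE => /andP[xv _]; exists x => //; rewrite -ex setD1K.
Qed.

Lemma coverS (A B : {set {set I}}) : A \subset B -> cover A \subset cover B.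
Proof.
move=> /subsetP AB; apply/bigcupsP=> e /AB eB.
by apply/subsetP=> x xe; apply/bigcupP; exists e.
Qed.

Lemma disjoint_coverP (w : {set I}) (A : {set {set I}}) :
  reflect (forall e, e \in A -> [disjoint w & e]) [disjoint w & cover A].
Proof. exact: bigcup_disjointP. Qed.

Lemma edge_coversP (V : {set I}) (A : {set {set I}}) :
  reflect [/\ A \subset G, forall e, e \in A -> e \subset V &
              forall x, x \in V -> exists2 e, e \in A & x \in e]
          (A \in edge_covers V).
Proof.
rewrite inE; apply: (iffP andP) => [[AG /eqP AV]|[AG AV VA]].
  split=> // [e eA|x]; first by rewrite -AV; apply: bigcup_sup.
  by rewrite -AV => /bigcupP[e]; exists e.
split=> //; rewrite eqEsubset; apply/andP; split; first exact/bigcupsP.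
by apply/subsetP=> x /VA[e eA xe]; apply/bigcupP; exists e.
Qed.

(* With A' the set of edges of A avoiding v, and vz a fixed edge: if A' covers V \ v, toggle vz, which
   leaves the sets A' + vz; if A' does not cover V \ v, toggle vx for any edge wx of A. *)
Lemma reducible_edge_covers_dominated (V : {set I}) (v w : I) :
  v \in V -> w \in V -> v != w -> [set v; w] \notin G ->
  (forall x, x \in V -> [set w; x] \in G -> [set v; x] \in G) ->
  reducible (edge_covers (V :\ v)) -> reducible (edge_covers V).
Proof.
move=> vV wV vw vwG dom redV'.
have [->|[A0 /edge_coversP[/subsetP A0G A0V VA0]]] := set_0Vmem (edge_covers V).
  exact: reducible0.
have [z zV vzG] : exists2 z, z \in V & [set v; z] \in G.
  have [e eA ve] := VA0 v vV; have [z _ ez] := edge_other (A0G e eA) ve.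
  exists z; last by rewrite -ez A0G.
  by apply: (subsetP (A0V e eA)); rewrite ez set22.
set d := [set v; z].
pose away (A : {set {set I}}) := [set e in A | v \notin e].
have awayD1 (A : {set {set I}}) (e : {set I}) : v \in e -> away (A :\ e) = away A.
  move=> ve; apply/setP=> f; rewrite !inE; have [->|] //= := eqVneq f e.
  by rewrite ve andbF.
have awayU1 (A : {set {set I}}) (e : {set I}) : v \in e -> away (e |: A) = away A.
  by move=> ve; apply/setP=> f; rewrite !inE; have [->|] //= := eqVneq f e;
     rewrite ve andbF.
have awayS (A B : {set {set I}}) : A \subset B -> away A \subset away B.
  by move=> AB; apply/subsetP=> e; rewrite !inE => /andP[/(subsetP AB)-> ->].
have covAway (A : {set {set I}}) : A \in edge_covers V -> cover (away A) \subset V :\ v.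
  case/edge_coversP=> _ AV _; apply/bigcupsP=> e; rewrite inE => /andP[eA ve].
  by rewrite subsetD1 ve AV.
have coversU1 (e : {set I}) (A : {set {set I}}) : e \in G -> e \subset V -> A \in edge_covers V ->
    e |: A \in edge_covers V.
  move=> eG eV /edge_coversP[AG AV VA]; apply/edge_coversP; split.
  - by rewrite subUset sub1set eG.
  - by move=> f /setU1P[->|/AV].
  - by move=> x /VA[f fA xf]; exists f; rewrite // inE fA orbT.
have coversD1 (e : {set I}) (A : {set {set I}}) : A \in edge_covers V ->
    (forall x, x \in V -> x \in e -> exists2 f, f \in A & (f != e) && (x \in f)) ->
    A :\ e \in edge_covers V.
  move=> /edge_coversP[AG AV VA] cov; apply/edge_coversP; split.
  - exact: subset_trans (subD1set _ _) AG.
  - by move=> f /setD1P[_ /AV].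
  - move=> x xV; have [xe|xe] := boolP (x \in e).
      by have [f fA /andP[fe xf]] := cov x xV xe; exists f; rewrite // !inE fe.
    have [f fA xf] := VA x xV; exists f; rewrite // !inE fA andbT.
    by apply: contraNneq xe => <-.
have pairV x : x \in V -> [set v; x] \subset V.
  by move=> xV; apply/subsetP=> y; rewrite !inE => /orP[]/eqP->.
have inF (F : {set {set {set I}}}) (U : pred {set {set I}}) A :
    (A \in [set B in F | U B]) = (A \in F) && U A by rewrite inE.
apply: (@reducible_upset _ _ (fun A : {set {set I}} => cover (away A) == V :\ v)) => [A B AV BV AB /eqP cA||].
- by rewrite eqEsubset covAway // -cA coverS ?awayS.
(* Under [U], dropping [d] keeps [v] covered; the other points are covered by edges avoiding [v]. *)
- pose U (A : {set {set I}}) := [exists e in A, (v \in e) && (e != d)].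
  apply: (@reducible_upset _ _ U) => [A B _ _ AB /exists_inP[e eA eP]||].
  + by apply/exists_inP; exists e => //; apply: (subsetP AB).
  + apply: (@reducible_toggle _ _ d) => A.
    rewrite !inF => /andP[/andP[AV cA] /exists_inP[e eA /andP[ve ed]]].
    have Ud (B : {set {set I}}) : e \in B -> U B.
      by move=> eB; apply/exists_inP; exists e; rewrite // ve.
    rewrite awayU1 ?set21 // awayD1 ?set21 // cA !Ud ?in_setU1 ?in_setD1 ?eA ?orbT ?ed //.
    rewrite coversU1 ?pairV // coversD1 // => x xV _.
    have [->|xv] := eqVneq x v; first by exists e; rewrite // ed ve.
    have : x \in cover (away A) by rewrite (eqP cA) !inE xv.
    case/bigcupP=> f; rewrite inE => /andP[fA vf] xf; exists f; rewrite // xf andbT.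
    by apply: contraNneq vf => ->; rewrite set21.
  (* Without [U], the only edge of [A] at [v] is [d], and the other edges form an arbitrary edge
     cover of [V :\ v]. *)
  + apply: (@reducible_link _ d _ _ _ _ redV') => A; last first.
      case/edge_coversP=> _ AV _; apply/negP=> /AV.
      by rewrite subsetD1 set21 andbF.
    rewrite !inF; apply/idP/idP.
      case/andP=> /andP[/edge_coversP[AG AV VA] cA] nU.
      have dU e : e \in A -> v \in e -> e = d.
        move=> eA ve; apply/eqP; apply: contraNT nU => ed.
        by apply/exists_inP; exists e; rewrite // ve.
      have [e eA ve] := VA v vV; rewrite -{1}(dU e eA ve) eA /=.
      have <-: away A = A :\ d.
        apply/setP=> f; rewrite !inE andbC; case fA: (f \in A); rewrite ?andbF // !andbT.
        apply/idP/idP => [|fd]; first by apply: contraNneq => ->; rewrite set21.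
        by apply: contra fd => /(dU f fA)->.
      rewrite inE cA andbT; apply: subset_trans AG.
      by apply/subsetP=> f; rewrite inE => /andP[].
    case/andP=> dA AdV; have := AdV => /edge_coversP[AG AV VA].
    have awayE : away A = A :\ d.
      apply/setP=> f; rewrite !inE andbC; have [->|fd] := eqVneq f d.
        by rewrite set21.
      case fA: (f \in A); rewrite ?andbF //= andbT.
      have /AV : f \in A :\ d by rewrite !inE fd.
      by rewrite subsetD1 => /andP[_ ->].
    rewrite awayE; move: (AdV); rewrite inE => /andP[_ ->]; rewrite andbT.
    apply/andP; split.
      rewrite -(setD1K dA); apply/edge_coversP; split.
      * by rewrite subUset sub1set vzG.
      * move=> f /setU1P[->|/AV]; first exact: pairV.
        by rewrite subsetD1 => /andP[].
      * move=> x xV; have [->|xv] := eqVneq x v.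
          by exists d; rewrite ?setU11 ?set21.
        have [|f fA xf] := VA x; first by rewrite !inE xv.
        by exists f; rewrite // setU1r.
    apply/exists_inPn=> e eA; rewrite negb_and negbK -implybE.
    apply/implyP=> ve; apply: contraTT ve => ed.
    have /AV : e \in A :\ d by rewrite !inE ed.
    by rewrite subsetD1 => /andP[].
- have vxG (x : I) (A : {set {set I}}) : A \in edge_covers V -> [set w; x] \in A ->
      [/\ x \in V, x != v & [set v; x] \in G].
    case/edge_coversP=> /subsetP AG AV _ wxA.
    have xV : x \in V by apply: (subsetP (AV _ wxA)); rewrite set22.
    split=> //; last exact/dom/AG.
    by apply: contraNneq vwG => <-; rewrite setUC AG.
  apply: (@reducible_toggles _ I _ (fun x (A : {set {set I}}) => [set w; x] \in A)
                                   (fun x => [set v; x])).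
  + move=> A /setIdP[/edge_coversP[/subsetP AG _ VA] _].
    have [e eA we] := VA w wV; have [x _ ex] := edge_other (AG e eA) we.
    by exists x; rewrite -ex.
  + by move=> x A B _ _ /subsetP AB /AB.
  + move=> x A /setIdP[AV ncA] wxA; have [xV xv vxG'] := vxG x A AV wxA.
    rewrite !inF awayU1 ?set21 // awayD1 ?set21 // ncA !andbT.
    rewrite coversU1 ?pairV // coversD1 // => y yV.
    have wx : [set w; x] != [set v; x].
      apply: contraTneq (set21 v x) => <-; rewrite !inE negb_or vw.
      by rewrite eq_sym.
    (* Once [[set v; x]] is removed, [x] is still covered by [[set w; x]]. For [v], take a point [u]
       missed by [away A]: its edge in [A] contains [v], and [u] is not [x] because [[set w; x]]
       avoids [v]. *)
    case/set2P=> ->; last by exists [set w; x]; rewrite // wx set22.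
    have [u] : exists2 u, u \in V :\ v & u \notin cover (away A).
      by apply/subsetPn; apply: contra ncA => sub; rewrite eqEsubset covAway.
    rewrite !inE => /andP[uv uV] ucA.
    have [AG AV' VA] := edge_coversP _ _ AV; have [e eA ue] := VA u uV.
    have uaway f : f \in A -> u \in f -> v \in f.
      move=> fA uf; apply: contraNT ucA => vf.
      by apply/bigcupP; exists f; rewrite // inE fA.
    exists e; rewrite // (uaway e) // andbT.
    apply: contraTneq ue => ->; rewrite !inE negb_or uv.
    apply/negP=> /eqP ux; have := uaway _ wxA; rewrite ux set22 => /(_ isT).
    by rewrite !inE (negPf vw) eq_sym (negPf xv).
  + move=> x y A /setIdP[AV _] wxA; have [xV xv vxG'] := vxG x A AV wxA.
    have ne : [set w; y] != [set v; x].
      apply: contraNneq vwG => E; have := set21 v x; rewrite -E !inE (negPf vw) /=.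
      by move=> /eqP->; rewrite setUC E.
    by rewrite !inE ne (negPf ne).
Qed.

End EdgeCovers.

(** * Stable and unstable pairs on the cycle *)

Section StableKneser.

Variable k : nat.
Local Notation n := k.+4.
Local Notation G := (stable_verts k).
Implicit Types (i x y a b : 'I_n) (e w : {set 'I_n}) (A B Z : {set {set 'I_n}}).

Definition gap i : {set 'I_n} := [set i; (i + 1)%R].

(** Number of steps from [i] forward to [x] around the cycle; it turns cyclic adjacency into
    arithmetic on natural numbers. *)
Definition pos i x : nat := val (x - i)%R.

Lemma pos_lt i x : pos i x < n.
Proof. exact: ltn_ord. Qed.

Lemma pos_inj i : injective (pos i).
Proof. by move=> x y /val_inj /GRing.addIr. Qed.

Lemma pos_onto i t : t < n -> exists x, pos i x = t.
Proof. by move=> tn; exists (Ordinal tn + i)%R; rewrite /pos GRing.addrK. Qed.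

Lemma pos0 i : pos i i = 0.
Proof. by rewrite /pos GRing.subrr. Qed.

Lemma posS i x : 
  pos i (x + 1)%R = if (pos i x).+1 == n then 0 else (pos i x).+1.
Proof.
rewrite /pos GRing.addrAC /= addn1 -/(pos i x); case: eqP => [->|/eqP ne].
  by rewrite modnn.
by rewrite modn_small // ltn_neqAle ne pos_lt.
Qed.

Lemma mem_gap i x : (x \in gap i) = (pos i x < 2).
Proof.
have pos1 : pos i (i + 1)%R = 1 by rewrite posS pos0.
by rewrite !inE -!(inj_eq (@pos_inj i)) pos0 pos1; case: (pos i x) => [|[]].
Qed.

Lemma pair_kneser x y : ([set x; y] \in kneser_verts k) = (x != y).
Proof. by rewrite inE cards2 eqSS eqb1. Qed.

Lemma pair_stable x y :
  ([set x; y] \in G) = [&& x != y, y != (x + 1)%R & x != (y + 1)%R].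
Proof.
have sub1 (z t : 'I_n) : (z == t - 1)%R = (t == z + 1)%R.
  by rewrite eq_sym GRing.subr_eq.
have nz (z : 'I_n) : ((z == z + 1) = false)%R.
  by rewrite -(inj_eq (@pos_inj z)) posS pos0.
rewrite inE pair_kneser; case: eqVneq => //= _.
apply/forall_inP/andP => [st|[yx xy] a].
  have /forall_inP/(_ y)/= := st x (set21 _ _).
  by rewrite set22 sub1 => /(_ isT)/andP[].
by case/set2P=> ->; apply/forall_inP=> b /set2P[]->; rewrite ?sub1 ?nz // ?yx ?xy.
Qed.

Lemma stableP e : reflect (exists x y, e = [set x; y] /\ [set x; y] \in G) (e \in G).
Proof.
apply: (iffP idP) => [eG|[x [y [-> //]]]].
move: (eG); rewrite !inE => /andP[/cards2P[x [y [_ ee]]] _].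
by exists x, y; rewrite -ee.
Qed.

Lemma stable_kneser e : e \in G -> e \in kneser_verts k.
Proof. by rewrite inE => /andP[]. Qed.

Lemma gap_kneser i : gap i \in kneser_verts k.
Proof. by rewrite pair_kneser -(inj_eq (@pos_inj i)) posS pos0. Qed.

Lemma gap_stable i : gap i \notin G.
Proof. by rewrite pair_stable eqxx /= andbF. Qed.

Lemma unstable_gap e : e \in kneser_verts k -> e \notin G -> exists i, e = gap i.
Proof.
rewrite {1}inE => /cards2P[x [y [xy ->]]]; rewrite pair_stable xy /= negb_and !negbK.
by case/orP=> /eqP->; [exists x | exists y; rewrite setUC].
Qed.

(** Off the gap, positions run from 2 to [k + 3], and one step past the end lands on position 0,
    inside the gap. These points therefore form a path, and stable pairs are the edges of its
    complement. *)
Lemma stable_pos i x y : x \notin gap i -> y \notin gap i ->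
  ([set x; y] \in G) = (pos i x + 2 <= pos i y) || (pos i y + 2 <= pos i x).
Proof.
rewrite !mem_gap -!leqNgt => x2 y2; rewrite pair_stable.
rewrite -!(inj_eq (@pos_inj i)) !posS; have := pos_lt i x; have := pos_lt i y.
move: (pos i x) (pos i y) x2 y2 => p q p2 q2 ltq ltp.
by case: (p.+1 =P n) => ?; case: (q.+1 =P n) => ?; lia.
Qed.

(** Points are deleted from the start of the path: a neighbour of the second point lies at least two
    steps beyond it, hence is also a neighbour of the first. *)
Lemma reducible_gap_edge_covers i : reducible (edge_covers G (~: gap i)).
Proof.
have G2 e : e \in G -> #|e| = 2 by move/stable_kneser; rewrite inE => /eqP.
pose V t := [set x | t <= pos i x].
have ->: ~: gap i = V 2 by apply/setP=> x; rewrite in_setC mem_gap -leqNgt inE.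
have outP t x : 2 <= t -> t <= pos i x -> x \notin gap i.
  by move=> t2 tx; rewrite mem_gap -leqNgt (leq_trans t2).
suff red d t : 2 <= t -> d + t = k.+3 -> reducible (edge_covers G (V t)).
  by apply: (red k.+1) => //; rewrite addn2.
elim: d t => [|d IH] t t2 dt.
  (* Here [t] is the last position [k + 3], and [V t] is a single point. *)
  suff ->: edge_covers G (V t) = set0 by apply: reducible0.
  apply/setP=> A; rewrite [RHS]inE; apply/negP=> /edge_coversP[/subsetP AG AV VA].
  have [x xt] : exists x, pos i x = t by apply: pos_onto; rewrite -dt.
  have [|e eA xe] := VA x; first by rewrite inE xt.
  have [y yx ey] := edge_other G2 (AG e eA) xe.
  have : y \in V t by apply: (subsetP (AV e eA)); rewrite ey set22.
  rewrite inE => ty; have := pos_lt i y; rewrite -(inj_eq (@pos_inj i)) in yx.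
  by lia.
have [|x xt] := @pos_onto i t; first by lia.
have [|y yt] := @pos_onto i t.+1; first by lia.
have [xo yo] : x \notin gap i /\ y \notin gap i by rewrite !(outP t) // ?xt ?yt.
apply: (@reducible_edge_covers_dominated _ _ G2 _ x y).
- by rewrite inE xt.
- by rewrite inE yt leqW.
- by rewrite -(inj_eq (@pos_inj i)) xt yt neq_ltn leqnn.
- by rewrite (stable_pos (i := i)) // xt yt; lia.
- move=> z; rewrite inE => tz; have zo := outP t z t2 tz.
  by rewrite !(stable_pos (i := i)) // xt yt; lia.
suff ->: V t :\ x = V t.+1 by apply: IH; lia.
by apply/setP=> z; rewrite !inE -(inj_eq (@pos_inj i)) xt; lia.
Qed.

(** The pair [e_x], meant for [x] outside the gap. It uses [i], except when [x] is the predecessor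
    of [i], which is two steps away from [i + 1]. *)
Definition spoke i x : {set 'I_n} :=
  if (x + 1)%R == i then [set (i + 1)%R; x] else [set i; x].

Lemma spoke_stable i x : x \notin gap i -> spoke i x \in G.
Proof.
rewrite mem_gap /spoke -(inj_eq (@pos_inj i)) (fun_if (fun e => e \in G)).
rewrite !pair_stable -!(inj_eq (@pos_inj i)) !posS pos0; have := pos_lt i x.
move: (pos i x) => p; case: (p.+1 =P n) => ? /=; lia.
Qed.

Lemma spoke_set i x : exists2 a, a \in gap i & spoke i x = [set a; x].
Proof.
rewrite /spoke; case: eqP => _; first by exists (i + 1)%R; rewrite ?set22.
by exists i; rewrite ?set21.
Qed.

Lemma mem_spoke i x y : y \notin gap i -> (y \in spoke i x) = (y == x).
Proof.
have [a ag ->] := spoke_set i x => yg; rewrite !inE orb_idl // => /eqP ya.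
by rewrite ya ag in yg.
Qed.

(** * Simplices of the two neighborhood complexes *)

Lemma mem_S2 i A : gap i \in A ->
  (A \in simplices (neighborhood_complex (S2 k))) =
  (A \subset kneser_verts k) && [exists w in G, [disjoint w & cover A]].
Proof.
move=> gA; rewrite inE; have -> /= : A != set0 by apply/set0Pn; exists (gap i).
apply: andb_id2l => /subsetP AK; apply/exists_inP/exists_inP => -[w wK wA].
  (* An edge of [S2] at the unstable pair [gap i] has a stable other end. *)
  have := forall_inP wA _ gA => /andP[_]; rewrite (negPf (gap_stable i)) orbF => wG.
  exists w => //; apply/disjoint_coverP=> e eA.
  have /andP[/and3P[_ _ we] _] := forall_inP wA e eA.
  by rewrite -setI_eq0.
exists w; first exact: stable_kneser.
apply/forall_inP=> e eA; apply/andP; split; last by rewrite wK.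
apply/and3P; split; [exact: stable_kneser | exact: AK |].
by rewrite setI_eq0 (disjoint_coverP _ _ wA).
Qed.

Lemma mem_SG2 A :
  (A \in simplices (neighborhood_complex (SG2 k))) =
  [&& A != set0, A \subset G & [exists w in G, [disjoint w & cover A]]].
Proof.
rewrite inE; apply: andb_id2l => _.
have -> : verts (SG2 k) = G by apply/setIidPr/subsetP=> e /stable_kneser.
apply: andb_id2l => /subsetP AG; apply: eq_existsb => w; apply: andb_id2l => wG.
apply/forall_inP/disjoint_coverP => wA e eA.
  by have /and3P[_ _ /and3P[_ _]] := wA e eA; rewrite setI_eq0.
apply/and3P; split=> //; first exact: AG.
by apply/and3P; split; [exact: stable_kneser | exact/stable_kneser/AG | rewrite setI_eq0 wA].
Qed.

Lemma SG2_sub_S2 :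
  simplices (neighborhood_complex (SG2 k)) \subset simplices (neighborhood_complex (S2 k)).
Proof.
apply/subsetP=> A; rewrite mem_SG2 inE => /and3P[-> /subsetP AG /exists_inP[w wG wA]].
rewrite /=; apply/andP; split; first by apply/subsetP=> e /AG/stable_kneser.
apply/exists_inP; exists w; first exact: stable_kneser.
apply/forall_inP=> e eA; apply/andP; split; last by rewrite wG.
apply/and3P; split; [exact: stable_kneser | exact/stable_kneser/AG |].
by rewrite setI_eq0 (disjoint_coverP _ _ wA).
Qed.

(** A stable common neighbour would put [A] in the smaller complex, so the common neighbour is some
    [gap i]. If a point outside it were missed by [A], the spoke of that point would be a stable
    common neighbour. *)
Lemma stable_simplex A :
  A \in simplices (neighborhood_complex (S2 k)) :\: simplices (neighborhood_complex (SG2 k)) ->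
  A \subset G -> exists i, cover A = ~: gap i.
Proof.
move=> /setDP[]; rewrite mem_SG2 inE => /and3P[A0 _ /exists_inP[w wK /forall_inP wA]] nA AG.
have dis : [disjoint w & cover A].
  by apply/disjoint_coverP=> e /wA/andP[/and3P[_ _]]; rewrite setI_eq0.
move: nA; rewrite A0 AG /= => /exists_inPn nA.
have [|i wi] := unstable_gap wK; first by apply: contraL dis => /nA.
exists i; apply/eqP; rewrite eqEsubset -disjoints_subset disjoint_sym -wi dis.
apply/subsetP=> x; rewrite wi inE => xg; apply: contraLR (nA _ (spoke_stable xg)).
move=> xA; rewrite negbK; have [a ag ->] := spoke_set i x.
rewrite -setI_eq0 -subset0; apply/subsetP=> y /setIP[/set2P[->|->]]; last by rewrite (negPf xA).
by move/disjointFr : dis => /(_ a); rewrite wi => ->.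
Qed.

Lemma gap_inj i j : gap i \subset gap j -> i = j.
Proof.
move=> /subsetP ij; apply: (@pos_inj j); rewrite pos0.
have := ij i (set21 _ _); have := ij _ (set22 _ _); rewrite !mem_gap posS.
by case: (pos j i) => [|[]].
Qed.

(** A stable common neighbour would be contained in [gap i], hence equal to it by size; [gap i]
    itself is a common neighbour in [S2], all members of [A] being stable. *)
Lemma mem_gap_cover i A : A \subset G -> cover A == ~: gap i ->
  A \in simplices (neighborhood_complex (S2 k)) :\: simplices (neighborhood_complex (SG2 k)).
Proof.
move=> /subsetP AG /eqP cA; rewrite inE mem_SG2; apply/andP; split.
  apply/negP=> /and3P[_ _ /exists_inP[w wG]]; rewrite cA disjoints_subset setCK => wg.
  have := gap_stable i; suff -> : gap i = w by rewrite wG.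
  apply/esym/eqP; rewrite eqEcard wg.
  by have := gap_kneser i; have := stable_kneser wG; rewrite !inE => /eqP-> /eqP->.
rewrite inE; apply/and3P; split.
- have [x xi] : exists x, pos i x = 2 by apply: pos_onto.
  apply/eqP=> A0; have : x \in cover A by rewrite cA inE mem_gap xi.
  by rewrite A0 /cover big_set0 inE.
- by apply/subsetP=> e /AG/stable_kneser.
apply/exists_inP; exists (gap i); first exact: gap_kneser.
apply/forall_inP=> e eA; apply/andP; split; last by rewrite (AG e eA) orbT.
apply/and3P; split; [exact: gap_kneser | exact/stable_kneser/AG |].
rewrite setI_eq0; apply: (disjoint_coverP _ _ _ e eA).
by rewrite cA -setI_eq0 setICr.
Qed.

(** Nested sets have nested unions, and the union determines [i]; so sets with different [i] are
    incomparable, and each fibre is a family of edge covers. *)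
Lemma reducible_stable :
  reducible [set A in simplices (neighborhood_complex (S2 k))
                        :\: simplices (neighborhood_complex (SG2 k)) | A \subset G].
Proof.
set F := [set _ in _ | _].
have coverF A : A \in F -> exists i, cover A = ~: gap i.
  by case/setIdP; apply: stable_simplex.
apply: (@reducible_last _ n F (fun t A => cover A == ~: gap (inord t))).
- by move=> A /coverF[i cA]; exists i; rewrite // inord_val cA.
- move=> t A B _ /coverF[j cB] AB /eqP cA; have := coverS AB.
  by rewrite cA cB setCS => /gap_inj->.
move=> t tn; have := reducible_gap_edge_covers (inord t).
congr reducible; apply/setP=> A; rewrite inE; set i := inord t.
apply/andP/setIdP => [[AG cA]|[/setIdP[_ AG] /andP[cA _]]]; last by [].
split; first by apply/setIdP; split=> //; apply: mem_gap_cover cA.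
rewrite cA; apply/forallP=> j; apply/implyP=> tj.
rewrite (eqP cA) (inj_eq (@setC_inj _)) inord_val; apply: contraTneq tj => gg.
have <- : i = j by apply: gap_inj; rewrite gg.
by rewrite inordK ?ltnn.
Qed.

(** * Simplices containing a given unstable pair *)

Definition gap_star i (Z : {set {set 'I_n}}) : {set {set {set 'I_n}}} :=
  [set A : {set {set 'I_n}} | [&& gap i \in A, A \subset kneser_verts k, [disjoint A & Z] &
            [exists w in G, [disjoint w & cover A]]]].

Lemma gap_starP i Z A :
  reflect [/\ gap i \in A, A \subset kneser_verts k, [disjoint A & Z] &
              exists2 w, w \in G & [disjoint w & cover A]]
          (A \in gap_star i Z).
Proof.
rewrite inE; apply: (iffP and4P) => -[? ? ? /exists_inP wA]; split=> //.
Qed.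

Lemma gap_starU1 i Z e A w : e \in G -> [disjoint Z & G] -> A \in gap_star i Z ->
  w \in G -> [disjoint w & e] -> [disjoint w & cover A] -> e |: A \in gap_star i Z.
Proof.
move=> eG ZG /gap_starP[gA AK AZ _] wG we wA; apply/gap_starP; split.
- by rewrite inE gA orbT.
- by rewrite subUset sub1set stable_kneser.
- by rewrite disjoints_subset subUset sub1set inE (disjointFl ZG eG) -disjoints_subset.
exists w => //; apply/disjoint_coverP=> f /setU1P[->//|fA].
exact: (disjoint_coverP _ _ wA).
Qed.

Lemma gap_starD1 i Z e A : e \in G -> A \in gap_star i Z -> A :\ e \in gap_star i Z.
Proof.
move=> eG /gap_starP[gA AK AZ [w wG wA]]; apply/gap_starP; split.
- by rewrite !inE gA andbT; apply: contraTneq eG => <-; rewrite gap_stable.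
- exact: subset_trans (subD1set _ _) AK.
- exact: disjointWl (subD1set _ _) AZ.
exists w => //; apply/disjoint_coverP=> f /setD1P[_ fA].
exact: (disjoint_coverP _ _ wA).
Qed.

Lemma reducible_gap_star i Z : [disjoint Z & G] -> reducible (gap_star i Z).
Proof.
move=> ZG.
(* At a thick point, toggling the spoke leaves the union of [A] unchanged, since the other end of
   the spoke lies in [gap i]. *)
pose thick x (A : {set {set 'I_n}}) := (x \notin gap i) && [exists e in A, (x \in e) && (e != spoke i x)].
have thickS x A B : A \subset B -> thick x A -> thick x B.
  move=> AB /andP[xg /exists_inP[e eA eP]]; rewrite /thick xg /=.
  by apply/exists_inP; exists e => //; apply: (subsetP AB).
have thickD x y A : thick x A -> thick x (A :\ spoke i y).
  move=> /andP[xg /exists_inP[e eA /andP[xe eP]]]; rewrite /thick xg /=.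
  apply/exists_inP; exists e; last by rewrite xe.
  (* The witness at [x] survives: a spoke through [x] can only be the spoke of [x] itself. *)
  rewrite !inE eA andbT; apply: contraNneq eP => E.
  by move: xe; rewrite E mem_spoke // => /eqP->.
have thickD1 x y A : thick x (A :\ spoke i y) = thick x A.
  by apply/idP/idP; [apply/thickS/subD1set | apply: thickD].
have thickU1 x y A : thick x (spoke i y |: A) = thick x A.
  apply/idP/idP; last exact/thickS/subsetUr.
  move/(@thickD _ y); apply: thickS; rewrite subDset; exact: subxx.
pose U (A : {set {set 'I_n}}) := [exists x, thick x A].
have UD1 y A : U (A :\ spoke i y) = U A by apply: eq_existsb => x.
have UU1 y A : U (spoke i y |: A) = U A by apply: eq_existsb => x.
have inF (F : {set {set {set 'I_n}}}) (V : pred {set {set 'I_n}}) A :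
    (A \in [set B in F | V B]) = (A \in F) && V A by rewrite inE.
apply: (@reducible_upset _ _ U) => [A B _ _ AB /existsP[x xA]||].
- by apply/existsP; exists x; apply: thickS xA.
- apply: (@reducible_toggles _ _ _ thick (spoke i)).
  + by move=> A /setIdP[_ /existsP].
  + by move=> x A B _ _; apply: thickS.
  + move=> x A; rewrite !inF => /andP[Astar UA] xA; rewrite UU1 UD1 UA !andbT.
    have /andP[xg /exists_inP[e eA /andP[xe _]]] := xA.
    rewrite gap_starD1 ?spoke_stable // andbT.
    have [gA _ _ [w wG wA]] := gap_starP _ _ _ Astar.
    apply: (gap_starU1 (w := w)) => //; first exact: spoke_stable.
    have [a ag ->] := spoke_set i x; rewrite disjoint_sym.
    rewrite disjoints_subset subUset !sub1set !inE.
    rewrite (disjointFl (disjoint_coverP _ _ wA _ gA) ag).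
    by rewrite (disjointFl (disjoint_coverP _ _ wA _ eA) xe).
  + by move=> x y A _ _; rewrite thickU1 thickD1.
(* For [t] at most 2 there is nothing to test. The last [t] with [P t A] will be the position of the
   first point whose spoke is missing from [A]. *)
pose P t (A : {set {set 'I_n}}) := [forall x, (2 <= pos i x < t) ==> (spoke i x \in A)].
apply: (@reducible_last _ n _ P) => [A _|t A B _ _ /subsetP AB /forallP PA|t tn].
- by exists 0 => //; apply/forallP=> x; rewrite ltn0 andbF.
- by apply/forallP=> x; apply/implyP=> xt; apply/AB/(implyP (PA x)).
set F := [set A in _ | _ & _].
have outP x s : 2 <= s -> s <= pos i x -> x \notin gap i.
  by move=> s2 sx; rewrite mem_gap -leqNgt (leq_trans s2).
have mem_cover A x : A \in gap_star i Z -> ~~ U A -> x \notin gap i ->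
    (x \in cover A) = (spoke i x \in A).
  move=> _ nU xg; apply/bigcupP/idP => [[e eA xe]|sA]; last first.
    by exists (spoke i x); rewrite ?mem_spoke.
  suff <-: e = spoke i x by [].
  apply/eqP; apply: contraNT nU => ne; apply/existsP; exists x.
  by rewrite /thick xg; apply/exists_inP; exists e; rewrite // xe.
(* The stable pair [w] avoids the union of [A], where positions from 2 up to [t - 1] are covered; so
   its lower end is at [t] or later, its upper end at [t + 2] or later. Hence [t + 1] is a legal
   index, and the failure of [P] there shows that position [t] is uncovered. *)
have factF A : A \in F ->
    [/\ A \in gap_star i Z, ~~ U A, P t A, 2 <= t & exists x b,
      [/\ pos i x = t, t + 2 <= pos i b, x \notin cover A & b \notin cover A]].
  move=> /setIdP[]; rewrite inF => /andP[Astar nU] /andP[PA /forallP nP].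
  have [gA _ _ [w wG wA]] := gap_starP _ _ _ Astar.
  have out z : z \in w -> z \notin gap i /\ z \notin cover A.
    move=> zw; rewrite (disjointFr wA zw); split=> //.
    by rewrite (disjointFr (disjoint_coverP _ _ wA _ gA) zw).
  have [a [b [ag bg aA bA ab]]] : exists a b, [/\ a \notin gap i, b \notin gap i,
      a \notin cover A, b \notin cover A & pos i a + 2 <= pos i b].
    have [a [b [wE wG']]] := stableP _ wG; move: wG'.
    have [ag aA] : a \notin gap i /\ a \notin cover A by apply: out; rewrite wE set21.
    have [bg bA] : b \notin gap i /\ b \notin cover A by apply: out; rewrite wE set22.
    by rewrite (stable_pos ag bg) => /orP[ab|ba]; [exists a, b | exists b, a].
  have ta : t <= pos i a.
    rewrite leqNgt; apply: contra aA => at_; rewrite (mem_cover _ _ Astar) //.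
    have /implyP := forallP PA a; apply; rewrite at_ andbT.
    by rewrite mem_gap -leqNgt in ag.
  have bn := pos_lt i b; have tn1 : t.+1 < n by clear -ta ab bn; lia.
  have := nP (Ordinal tn1); rewrite /= leqnn => /forallPn[x].
  rewrite negb_imply => /andP[/andP[x2 xt] xA].
  have xtE : pos i x = t.
    apply/eqP; rewrite eqn_leq -ltnS xt leqNgt; apply: contra xA => tx.
    by have /implyP := forallP PA x; apply; rewrite x2.
  split=> //; first by rewrite -xtE.
  exists x, b; split=> //; first by rewrite (leq_trans _ ab) // leq_add2r.
  by rewrite (mem_cover _ _ Astar) // mem_gap -leqNgt.
have [->|[A0 A0F]] := set_0Vmem F; first exact: reducible0.
have [_ _ _ t2 [_ [b0 [_ b0t _ _]]]] := factF A0 A0F.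
(* [y] sits strictly between two uncovered points, at [t] and at [t + 2] or later, so its spoke
   misses the stable pair they form. *)
have [|y yt] := @pos_onto i t.+1; first by apply: leq_ltn_trans (pos_lt i b0); rewrite (leq_trans _ b0t) // addn2 ltnW.
have spokeN z : z \notin gap i -> pos i z <= t -> spoke i z != spoke i y.
  move=> zg zt; apply: contraTneq (zt) => E.
  have : z \in spoke i z by rewrite mem_spoke.
  by rewrite E mem_spoke // => /eqP->; rewrite yt ltnn.
apply: (@reducible_toggle _ _ (spoke i y)) => A AF.
have [Astar nU PA _ [x [b [xt bt xA bA]]]] := factF A AF.
have [xg bg yg] : [/\ x \notin gap i, b \notin gap i & y \notin gap i].
  by split; rewrite mem_gap -leqNgt ?xt ?yt ?leqW //; clear -t2 bt; lia.
(* The missing spoke at position [t] refutes every later [P j], so toggling the spoke of [y] stays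
   in the same fibre. *)
have nP B : spoke i x \notin B -> [forall j : 'I_n, (t < j) ==> ~~ P j B].
  move=> xB; apply/forallP=> j; apply/implyP=> tj; apply/forallPn; exists x.
  by rewrite negb_imply xB xt t2 tj.
have sxA : spoke i x \notin A by rewrite -(mem_cover A).
have toggledP B : B \in gap_star i Z -> ~~ U B -> P t B -> spoke i x \notin B -> B \in F.
  move=> Bstar nUB PB xB; apply/setIdP; split; first by rewrite inF Bstar.
  by rewrite PB nP.
apply/andP; split; apply: toggledP; rewrite ?UU1 ?UD1 //.
- have yG := spoke_stable yg.
  apply: (gap_starU1 (w := [set x; b])) => //.
  + by rewrite (stable_pos xg bg) xt bt.
  + rewrite disjoint_subset; apply/subsetP=> z /set2P[]->; rewrite inE mem_spoke //;
      rewrite -(inj_eq (@pos_inj i)) yt; clear -xt bt; lia.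
  + by rewrite disjoint_subset; apply/subsetP=> z /set2P[]->; rewrite inE.
- apply/forallP=> z; apply/implyP=> zt; rewrite in_setU1.
  by rewrite (implyP (forallP PA z)) ?orbT.
- by rewrite in_setU1 negb_or sxA spokeN ?xt.
- exact: gap_starD1 (spoke_stable yg) Astar.
- apply/forallP=> z; apply/implyP=> /[dup] /andP[z2 zt] zt'; rewrite in_setD1.
  by rewrite (implyP (forallP PA z)) // andbT spokeN ?(ltnW zt) ?(outP z 2).
- by rewrite in_setD1 negb_and sxA orbT.
Qed.

Lemma reducible_unstable :
  reducible [set A in simplices (neighborhood_complex (S2 k))
                        :\: simplices (neighborhood_complex (SG2 k)) | ~~ (A \subset G)].
Proof.
set F := [set A in _ | _].
apply: (@reducible_last _ n F (fun t (A : {set {set 'I_n}}) => gap (inord t) \in A)).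
- move=> A /setIdP[/setDP[AS _] /subsetPn[e eA eG]].
  have /subsetP AK : A \subset kneser_verts k by move: AS; rewrite inE => /and3P[].
  have [i ei] := unstable_gap (AK e eA) eG.
  by exists i; rewrite // inord_val -ei.
- by move=> t A B _ _ /subsetP AB /AB.
move=> t tn; set i := inord t.
(* Excluding the unstable pairs of larger index makes [gap i] the last one in [A]; spokes are
   stable, so toggling them never meets [Z]. *)
pose Z := [set gap j | j : 'I_n & t < j].
have ZG : [disjoint Z & G].
  by rewrite disjoint_subset; apply/subsetP=> e /imsetP[j _ ->]; apply: gap_stable.
have := reducible_gap_star i ZG; congr reducible; apply/setP=> A.
apply/gap_starP/setIdP => [[gA AK AZ wA]|[/setIdP[/setDP[AS _] _] /andP[gA /forallP nZ]]].
  have AG : ~~ (A \subset G) by apply/subsetPn; exists (gap i); rewrite ?gap_stable.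
  split.
    apply/setIdP; split=> //; apply/setDP; split; last by rewrite mem_SG2 (negPf AG) andbF.
    by rewrite (mem_S2 gA) AK; apply/exists_inP.
  rewrite gA; apply/forallP=> j; apply/implyP=> tj.
  by rewrite inord_val (disjointFl AZ) // imset_f // inE.
move: AS; rewrite (mem_S2 gA) => /andP[AK /exists_inP wA]; split=> //.
rewrite disjoint_sym disjoint_subset; apply/subsetP=> e /imsetP[j].
by rewrite inE => tj ->; have := nZ j; rewrite tj inord_val.
Qed.

End StableKneser.

Theorem theorem1p1 (k : nat) :
  collapses (neighborhood_complex (S2 k)) (neighborhood_complex (SG2 k)).
Proof.
apply: reducible_collapses; first exact: SG2_sub_S2.
(* Having an unstable member passes to supersets, so these simplices are removed first. *)
apply: (@reducible_upset _ _ (fun A => ~~ (A \subset stable_verts k))) => [A B _ _ AB||].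
- by apply: contra; apply: subset_trans.
- exact: reducible_unstable.
by have := reducible_stable k; congr reducible; apply/setP=> A; rewrite !inE negbK.
Qed.
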